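(* With the setting and notation of the context, let $\gamma=(\gamma_i)_{i\in I^c}$ with $\gamma_i>0$ and assume $\Vert f_i\Vert_{i,\gamma}\le\gamma_i$ for all $i\in I^c$. Then for all $a,a'\in A$, $$ \Vert D(a)-D(a')\Vert_X\le\Big(1+\sum_{i\in I^c}\gamma_i^2\Big)^{1/2}\Vert a-a'\Vert_2. $$
   Context: $X$ is a (real) Hilbert space with inner product $(\cdot,\cdot)_X$ and norm $\Vert\cdot\Vert_X$, and $M\subset X$ is a subset. Let $\bar u\in X$ and let $\varphi_1,\dots,\varphi_N$ be an orthonormal basis of an $N$-dimensional subspace $X_N\subset X$. Let $I=\{i_1,\dots,i_n\}\subset\{1,\dots,N\}$ have $n$ elements and $I^c=\{1,\dots,N\}\setminus I$. Write $\ell_2(I)$ for $\mathbb{R}^n$ with the Euclidean norm $\Vert\cdot\Vert_2$, the $k$-th coordinate $a_k$ of $a\in\ell_2(I)$ corresponding to the index $i_k\in I$. Encoder: $E:X\to\ell_2(I)$, $E(u)=((u-\bar u,\varphi_i)_X)_{i\in I}$ (i.e. its $k$-th coordinate is $(u-\bar u,\varphi_{i_k})_X$). Let $A=\{E(u):u\in M\}\subset\ell_2(I)$. Decoder: $D:\ell_2(I)\to X$, $D(a)=\bar u+\sum_{i=1}^N g_i(a)\varphi_i$, where $g_{i_k}(a)=a_k$ for $k=1,\dots,n$, and for $i\in I^c$, $g_i(a)=f_i((g_j(a))_{j\in S_i})$ with $S_i=\{1,\dots,n_i\}$, $n_i<i$, and $f_i:\mathbb{R}^{n_i}\to\mathbb{R}$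 an $n_i$-variate polynomial. For $i\in I^c$ let $B_i=\{(g_j(a))_{j\in S_i}:a\in A\}\subset\mathbb{R}^{n_i}$. Given $\gamma=(\gamma_i)_{i\in I^c}$ with $\gamma_i>0$, equip $\mathbb{R}^{n_i}$ (whose coordinates are indexed by $S_i$) with the norm $$ \Vert b\Vert_{i,\gamma}=\max\Big\{\Vert(b_j)_{j\in I\cap S_i}\Vert_2,\ \max_{j\in S_i\cap I^c}\gamma_j^{-1}|b_j|\Big\}, $$ where a term over an empty index set is $0$, and define the Lipschitz norm of $f_i:B_i\to\mathbb{R}$ by $$ \Vert f_i\Vert_{i,\gamma}=\sup_{b,b'\in B_i,\ b\ne b'}\frac{|f_i(b)-f_i(b')|}{\Vert b-b'\Vert_{i,\gamma}} $$ (equal to $0$ if $B_i$ has at most one point). *)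

(* Defs.v *)
From mathcomp Require Import all_boot all_order all_algebra.
From mathcomp Require Import all_classical all_reals all_analysis.
(* Not imported: its notations clash with those of MathComp-Analysis. *)
From mathcomp Require mpoly.

Set Implicit Arguments.
Unset Strict Implicit.
Unset Printing Implicit Defensive.

Import Order.TTheory GRing.Theory Num.Theory.
Import numFieldNormedType.Exports.

Local Open Scope classical_set_scope.
Local Open Scope ring_scope.

(* Indices are 0-based: the index i of {1, ..., N} is i - 1 : 'I_N.  The
   condition n_i < i becomes n_i <= (i - 1), i.e. n_i : 'I_i.+1 below, and
   S_i = {1, ..., n_i} becomes {j : 'I_N | j < n_i}.  The families n_i, f_i and
   gamma_i, indexed by the complement of I, are extended to all of 'I_N; their
   values on I are never used. *)

(* On 'rV[R]_n the library norm `|a| is the sup norm, hence: *)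
Definition l2norm (R : realType) (n : nat) (a : 'rV[R]_n) : R :=
  Num.sqrt (\sum_(k < n) a 0 k ^+ 2).

Definition orthonormal_basis (R : realType) (X : completeNormedModType R)
    (dot : {dot X for idfun}) (N : nat) (phi : 'I_N -> X) (XN : set X) : Prop :=
  (forall i j, dot (phi i) (phi j) = (i == j)%:R) /\
  XN = [set x | exists c : 'I_N -> R, x = \sum_(i < N) c i *: phi i].

Definition prefix_ord (N : nat) (i : 'I_N) (m : 'I_i.+1) (j : 'I_m) : 'I_N :=
  widen_ord (leq_trans (leq_ord m) (ltnW (ltn_ord i))) j.

Definition prefix_row (R : realType) (N : nat) (c : 'I_N -> R)
    (i : 'I_N) (m : 'I_i.+1) : 'rV[R]_m :=
  \row_(j < m) c (prefix_ord j).

Definition peval (R : realType) (m : nat) (p : mpoly.mpoly m R)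
    (b : 'rV[R]_m) : R := mpoly.meval (b 0) p.

Definition encoder (R : realType) (X : completeNormedModType R)
    (dot : {dot X for idfun}) (ubar : X) (N : nat) (phi : 'I_N -> X)
    (n : nat) (idx : 'I_n -> 'I_N) (u : X) : 'rV[R]_n :=
  \row_(k < n) dot (u - ubar) (phi (idx k)).

Section Coefficients.
Context (R : realType) (N n : nat) (idx : 'I_n -> 'I_N).
Context (nn : forall i : 'I_N, 'I_i.+1).
Context (f : forall i : 'I_N, mpoly.mpoly (nn i) R).

Definition coef_step (a : 'rV[R]_n) (c : 'I_N -> R) (i : 'I_N) : R :=
  if [pick k | idx k == i] is Some k then a 0 k
  else peval (f i) (prefix_row c (nn i)).

(* g_i(a): since f_i only reads coordinates of smaller index, N iterations from
   any starting point reach the solution of the recursive equations, which are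
   coef_idx and coef_poly below. *)
Definition coef (a : 'rV[R]_n) : 'I_N -> R := iter N (coef_step a) (fun=> 0).

Lemma coef_stepP (a : 'rV[R]_n) : coef_step a (coef a) =1 coef a.
Proof.
have H m : forall i : 'I_N, (i < m)%N ->
    iter m.+1 (coef_step a) (fun=> 0) i = iter m (coef_step a) (fun=> 0) i.
  elim: m => // m IH i im.
  change (coef_step a (iter m.+1 (coef_step a) (fun=> 0)) i =
          coef_step a (iter m (coef_step a) (fun=> 0)) i).
  rewrite /coef_step; case: pickP => // _; congr peval; apply/rowP => j.
  rewrite !mxE; apply: IH => /=.
  by rewrite (leq_trans (ltn_ord j))// (leq_trans (leq_ord _)).
by move=> i; exact: (H N i (ltn_ord i)).
Qed.

Lemma coef_idx (a : 'rV[R]_n) (k : 'I_n) :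
  injective idx -> coef a (idx k) = a 0 k.
Proof.
move=> inj; rewrite -coef_stepP /coef_step; case: pickP => [l /eqP/inj-> //|].
by move/(_ k); rewrite eqxx.
Qed.

Lemma coef_poly (a : 'rV[R]_n) (i : 'I_N) : i \notin [set idx k | k : 'I_n]%SET ->
  coef a i = peval (f i) (prefix_row (coef a) (nn i)).
Proof.
move=> iI; rewrite -{1}coef_stepP /coef_step; case: pickP => // k /eqP ki.
by rewrite -ki imset_f in iI.
Qed.

Definition decoder (X : completeNormedModType R) (ubar : X) (phi : 'I_N -> X)
    (a : 'rV[R]_n) : X :=
  ubar + \sum_(i < N) coef a i *: phi i.

Definition coef_dom (A : set 'rV[R]_n) (i : 'I_N) : set 'rV[R]_(nn i) :=
  [set prefix_row (coef a) (nn i) | a in A].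

End Coefficients.
Arguments coef_dom {R N n} idx {nn} f A i _.

Definition weighted_norm (R : realType) (N : nat) (I : {set 'I_N})
    (gamma : 'I_N -> R) (i : 'I_N) (m : 'I_i.+1) (b : 'rV[R]_m) : R :=
  Num.max
    (Num.sqrt (\sum_(j < m | prefix_ord j \in I) b 0 j ^+ 2))
    (\big[Num.max/0]_(j < m | prefix_ord j \notin I)
        ((gamma (prefix_ord j))^-1 * `|b 0 j|)).
Arguments weighted_norm {R N} I gamma i m b.

(* Extended-real valued, as the supremum may be infinite.  All quotients are
   nonnegative for a norm nrm, so adjoining 0 only makes the supremum 0 when B
   has at most one point (ereal_sup set0 = -oo). *)
Definition lipschitz_norm (R : realType) (m : nat) (nrm : 'rV[R]_m -> R)
    (B : set 'rV[R]_m) (F : 'rV[R]_m -> R) : \bar R :=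
  ereal_sup (0%:E |` [set q | exists b b', [/\ B b, B b', b != b' &
    q = (`|F b - F b'| / nrm (b - b'))%:E]]).

(* Main.v *)
Require Import Defs.
From mathcomp Require Import all_boot all_order all_algebra.
From mathcomp Require Import all_classical all_reals all_analysis.
From mathcomp Require mpoly.

Import Order.TTheory GRing.Theory Num.Theory.
Import numFieldNormedType.Exports.

Local Open Scope classical_set_scope.
Local Open Scope ring_scope.

(** Write d_i = g_i(a) - g_i(a') for the coefficient differences and L for the
    Euclidean distance of a and a'.  By orthonormality the squared distance of
    D(a) and D(a') is the sum of all d_i^2 (lemma [dot_sum_orthonormal]).  The
    indices in I contribute exactly L^2, because there g_i reads off an entry of
    a, so everything reduces to |d_i| <= gamma_i * L for i outside I (lemma
    [coef_diff_le]).

    This is an induction along the order in which the coefficients are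
    computed.  The weighted norm is made for it: if the bound holds for all
    earlier indices outside I, then the prefix of d that f_i reads has weighted
    norm at most L, since gamma_j^-1 * |d_j| <= L there and the part indexed by
    I is a subfamily of a family of Euclidean norm L (lemma
    [weighted_norm_prefix_le]).  The Lipschitz constant gamma_i of f_i then
    gives the bound for d_i itself, with no accumulation of constants.  The
    weighted norm enters the Lipschitz quotient as a denominator, so it also has
    to be positive on nonzero vectors (lemma [weighted_norm_gt0]). *)

Lemma l2norm_ge0 (R : realType) (n : nat) (a : 'rV[R]_n) : 0 <= l2norm a.
Proof. exact: sqrtr_ge0. Qed.

Lemma l2norm_sqr (R : realType) (n : nat) (a : 'rV[R]_n) :
  l2norm a ^+ 2 = \sum_(k < n) a 0 k ^+ 2.
Proof. by rewrite sqr_sqrtr// sumr_ge0// => k _; exact: sqr_ge0. Qed.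

Lemma dot_sum_orthonormal (R : realType) (X : completeNormedModType R)
    (dot : {dot X for idfun}) (N : nat) (phi : 'I_N -> X) (c : 'I_N -> R) :
  (forall i j, dot (phi i) (phi j) = (i == j)%:R) ->
  dot (\sum_(i < N) c i *: phi i) (\sum_(i < N) c i *: phi i) =
  \sum_(i < N) c i ^+ 2.
Proof.
move=> ortho; rewrite linear_sumlz; apply: eq_bigr => i _.
rewrite linearZl_LR linear_sumr (bigD1 i)//= big1 => [|j ji].
  by rewrite linearZr_LR /= ortho eqxx addr0 mulr1 expr2.
by rewrite linearZr_LR /= ortho eq_sym (negbTE ji) mulr0.
Qed.

(** Division by 0 gives 0, so a pair of points with [nrm (b - b') = 0] would put
    no constraint on [F]: positivity has to be assumed. *)
Lemma lipschitz_norm_bound (R : realType) (m : nat) (nrm : 'rV[R]_m -> R)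
    (B : set 'rV[R]_m) (F : 'rV[R]_m -> R) (c : R) (b b' : 'rV[R]_m) :
  (lipschitz_norm nrm B F <= c%:E)%E -> B b -> B b' -> b != b' ->
  0 < nrm (b - b') -> `|F b - F b'| <= c * nrm (b - b').
Proof.
move=> Fc Bb Bb' bb' nrm_gt0; rewrite -ler_pdivrMr// -lee_fin.
by apply: le_trans Fc; apply: ereal_sup_ubound; right; exists b, b'.
Qed.

Lemma prefix_ord_inj (N : nat) (i : 'I_N) (m : 'I_i.+1) :
  injective (@prefix_ord N i m).
Proof. by move=> j k /(congr1 val) /= jk; apply: val_inj. Qed.

Lemma prefix_ord_lt (N : nat) (i : 'I_N) (m : 'I_i.+1) (j : 'I_m) :
  (prefix_ord j < i)%N.
Proof. exact: leq_trans (ltn_ord j) (leq_ord m). Qed.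

Lemma prefix_rowB (R : realType) (N : nat) (c c' : 'I_N -> R) (i : 'I_N)
    (m : 'I_i.+1) :
  prefix_row c m - prefix_row c' m = prefix_row (fun j => c j - c' j) m.
Proof. by apply/rowP => j; rewrite !mxE. Qed.

(** The prefix embedding is injective, so the left side is a subsum of the right
    one. *)
Lemma ler_sum_prefix (R : realType) (N : nat) (P : pred 'I_N) (F : 'I_N -> R)
    (i : 'I_N) (m : 'I_i.+1) : (forall j, 0 <= F j) ->
  \sum_(j < m | P (prefix_ord j)) F (prefix_ord j) <= \sum_(j < N | P j) F j.
Proof.
move=> F_ge0.
rewrite -(big_imset (h := @prefix_ord N i m)
  (A := [pred j | P (prefix_ord j)]) F) /=; last by move=> ? ? _ _ /prefix_ord_inj.
rewrite [leRHS](bigID (mem [set prefix_ord j | j in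
  [pred j : 'I_m | P (prefix_ord j)]]%SET)) /=.
rewrite (eq_bigl (fun j => P j && (j \in [set prefix_ord j | j in
  [pred j : 'I_m | P (prefix_ord j)]]%SET))) ?lerDl ?sumr_ge0// => j.
by rewrite andbC; apply/esym/andb_idr => /imsetP[k]; rewrite inE => Pk ->.
Qed.

(** A nonzero entry of [b] makes one of the two terms of the maximum positive: the
    Euclidean one if its index is in [I], the other one if not. *)
Lemma weighted_norm_gt0 (R : realType) (N : nat) (I : {set 'I_N})
    (gamma : 'I_N -> R) (i : 'I_N) (m : 'I_i.+1) (b : 'rV[R]_m) :
  (forall i, i \notin I -> 0 < gamma i) -> b != 0 ->
  0 < weighted_norm I gamma i m b.
Proof.
move=> gamma_gt0 /rV0Pn[j bj0]; rewrite /weighted_norm lt_max.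
have [jI|jI] := boolP (prefix_ord j \in I); apply/orP; [left|right].
  rewrite sqrtr_gt0 (bigD1 j)//= ltr_wpDr ?exprn_even_gt0//.
  by rewrite sumr_ge0// => k _; exact: sqr_ge0.
apply: lt_le_trans (le_bigmax_cond _
  (fun j => (gamma (prefix_ord j))^-1 * `|b 0 j|) jI).
by rewrite mulr_gt0 ?invr_gt0 ?gamma_gt0 ?normr_gt0.
Qed.

(** The weights cancel the factors [gamma j] in the assumed bounds, which is why
    the same [L], without any constant, bounds both terms of the maximum. *)
Lemma weighted_norm_prefix_le (R : realType) (N : nat) (I : {set 'I_N})
    (gamma d : 'I_N -> R) (L : R) (i : 'I_N) (m : 'I_i.+1) :
  (forall i, i \notin I -> 0 < gamma i) -> 0 <= L ->
  \sum_(j in I) d j ^+ 2 <= L ^+ 2 ->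
  (forall j : 'I_N, (j < i)%N -> j \notin I -> `|d j| <= gamma j * L) ->
  weighted_norm I gamma i m (prefix_row d m) <= L.
Proof.
move=> gamma_gt0 L_ge0 dI dIc; rewrite /weighted_norm ge_max; apply/andP; split.
  rewrite -[leRHS](ger0_norm L_ge0) -sqrtr_sqr ler_wsqrtr//.
  apply: le_trans dI; under eq_bigr do rewrite mxE.
  exact: (@ler_sum_prefix _ _ (mem I) (fun j => d j ^+ 2) _ _
    (fun=> sqr_ge0 _)).
apply: bigmax_le => // j jI.
by rewrite mxE mulrC ler_pdivrMr ?gamma_gt0// mulrC dIc// prefix_ord_lt.
Qed.

Section CoefficientDifferences.
Context (R : realType) (N n : nat) (idx : 'I_n -> 'I_N).
Context (idx_inj : injective idx).
Context (nn : forall i : 'I_N, 'I_i.+1) (f : forall i, mpoly.mpoly (nn i) R).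
Let I : {set 'I_N} := [set idx k | k : 'I_n]%SET.

Lemma sum_coef_diff_sqr (a a' : 'rV[R]_n) :
  \sum_(i in I) (coef idx f a i - coef idx f a' i) ^+ 2 = l2norm (a - a') ^+ 2.
Proof.
rewrite l2norm_sqr big_imset /=; last by move=> ? ? _ _ /idx_inj.
by apply: eq_bigr => k _; rewrite !coef_idx// !mxE.
Qed.

(** Strong induction on [i]: [f i] reads only coordinates before [i]; by the
    induction hypothesis outside [I] and [sum_coef_diff_sqr] on [I], this prefix
    has moved by at most [l2norm (a - a')] in the weighted norm for which [f i]
    is [gamma i]-Lipschitz. *)
Lemma coef_diff_le (gamma : 'I_N -> R) (A : set 'rV[R]_n) (a a' : 'rV[R]_n) :
  (forall i, i \notin I -> 0 < gamma i) ->
  (forall i, i \notin I ->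
     (lipschitz_norm (weighted_norm I gamma i (nn i))
        (coef_dom idx f A i) (peval (f i)) <= (gamma i)%:E)%E) ->
  A a -> A a' -> forall i, i \notin I ->
  `|coef idx f a i - coef idx f a' i| <= gamma i * l2norm (a - a').
Proof.
move=> gamma_gt0 f_lip Aa Aa' i.
have [m] := ubnP (val i); elim: m => // m IH in i * => /ltnSE im iI.
rewrite !Defs.coef_poly//.
set b := prefix_row _ _; set b' := prefix_row _ _.
(* Equal prefixes are not covered by the Lipschitz norm, but then f_i takes
   the same value on both. *)
have [->|bb'] := eqVneq b b'.
  by rewrite subrr normr0 mulr_ge0 ?l2norm_ge0 ?ltW ?gamma_gt0.
apply: (le_trans (lipschitz_norm_bound _ _ _ _ _ _ _ _ (f_lip i iI) _ _ bb' _)).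
- by exists a.
- by exists a'.
- by apply: weighted_norm_gt0; rewrite ?subr_eq0.
rewrite ler_pM2l ?gamma_gt0// prefix_rowB.
apply: weighted_norm_prefix_le; rewrite ?l2norm_ge0 ?sum_coef_diff_sqr//.
by move=> j ji jI; apply: IH => //; exact: leq_trans ji im.
Qed.

End CoefficientDifferences.

Theorem proposition3p3 (R : realType) (X : completeNormedModType R)
    (dot : {dot X for idfun})
    (norm_dot : forall x : X, `|x| = Num.sqrt (dot x x))
    (M : set X) (ubar : X)
    (N : nat) (phi : 'I_N -> X) (XN : set X)
    (phi_basis : orthonormal_basis dot phi XN)
    (n : nat) (idx : 'I_n -> 'I_N) (idx_inj : injective idx)
    (I : {set 'I_N}) (I_def : I = [set idx k | k : 'I_n]%SET)
    (nn : forall i : 'I_N, 'I_i.+1)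
    (f : forall i : 'I_N, mpoly.mpoly (nn i) R)
    (gamma : 'I_N -> R)
    (gamma_gt0 : forall i, i \notin I -> 0 < gamma i) :
  let A := [set encoder dot ubar phi idx u | u in M] in
  let D := decoder idx f ubar phi in
  (forall i, i \notin I ->
     (lipschitz_norm (weighted_norm I gamma i (nn i))
        (coef_dom idx f A i) (peval (f i)) <= (gamma i)%:E)%E) ->
  forall a a' : 'rV[R]_n, A a -> A a' ->
    `|D a - D a'| <=
      Num.sqrt (1 + \sum_(i < N | i \notin I) gamma i ^+ 2) * l2norm (a - a').
Proof.
move=> A D f_lip a a' Aa Aa'; subst I.
have [ortho _] := phi_basis.
set L := l2norm _; have L_ge0 : 0 <= L by exact: l2norm_ge0.
have -> : D a - D a' = \sum_(i < N) (coef idx f a i - coef idx f a' i) *: phi i.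
  rewrite /D /decoder opprD addrACA subrr add0r -sumrB.
  by apply: eq_bigr => i _; rewrite scalerBl.
rewrite norm_dot dot_sum_orthonormal// -[leRHS]ger0_norm ?mulr_ge0 ?sqrtr_ge0//.
rewrite -sqrtr_sqr ler_wsqrtr// exprMn sqr_sqrtr; last first.
  by rewrite addr_ge0// sumr_ge0// => i _; exact: sqr_ge0.
rewrite (bigID (mem [set idx k | k : 'I_n]%SET)) /= sum_coef_diff_sqr//.
rewrite mulrDl mul1r lerD2l mulr_suml; apply: ler_sum => i iI.
rewrite -exprMn -[leLHS]real_normK ?num_real// lerXn2r ?nnegrE ?mulr_ge0//.
  by rewrite ltW ?gamma_gt0.
exact: coef_diff_le gamma_gt0 f_lip Aa Aa' i iI.
Qed.
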